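(* Let $T$ be the Kari–Culik set of 13 Wang tiles described in the context. Then $T$ tiles the plane and has positive entropy, i.e. $H(T)=\lim_{n\to\infty}\frac{\log C_T(n)}{n^2}>0$, where $C_T(n)$ is the number of distinct $n\times n$ square patterns that occur in at least one tiling of the plane $\mathbb{Z}^2$ by $T$.
   Context: A Wang tile is a unit square with a color on each of its four sides; a tiling of the plane is an assignment of a tile to every cell of $\mathbb{Z}^2$ such that adjacent tiles have equal colors on their common side (no rotations). The limit defining $H(T)$ exists. The Kari–Culik tileset $T$ uses horizontal-edge (top/bottom) colors $0,0',1,2$ and vertical-edge (left/right) colors from two disjoint state sets $\{s_0,s_1\}$ and $\{r_0,r_{1/3},r_{2/3}\}$. Writing a tile as (left, bottom, top, right), the 13 tiles are: $(s_0,0,0',s_0)$, $(s_1,0,0',s_1)$, $(s_0,1,2,s_0)$, $(s_1,1,2,s_1)$, $(s_0,1,1,s_1)$, $(s_1,0,1,s_0)$, $(s_1,0',1,s_0)$, $(r_0,2,1,r_{1/3})$, $(r_{1/3},2,1,r_{2/3})$, $(r_{1/3},1,0,r_0)$, $(r_{2/3},1,0,r_{1/3})$, $(r_0,1,1,r_{2/3})$, $(r_{2/3},2,0,r_0)$. *)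

(* Defs.v *)
From HB Require Import structures.
From mathcomp Require Import all_boot all_order all_algebra.
From mathcomp Require Import all_classical all_reals all_analysis.
Set Implicit Arguments. Unset Strict Implicit. Unset Printing Implicit Defensive.
Import Order.TTheory GRing.Theory Num.Theory.

Inductive hcol := H0 | H0' | H1 | H2.
(* Vertical-edge (left/right) colours: s_0, s_1, r_0, r_{1/3}, r_{2/3}. *)
Inductive vcol := S0 | S1 | R0 | R13 | R23.

Record wtile := WTile { wleft : vcol; wbottom : hcol; wtop : hcol; wright : vcol }.

Definition KC_list : seq wtile :=
  [:: WTile S0 H0 H0' S0; WTile S1 H0 H0' S1; WTile S0 H1 H2 S0; WTile S1 H1 H2 S1;
      WTile S0 H1 H1 S1; WTile S1 H0 H1 S0; WTile S1 H0' H1 S0;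
      WTile R0 H2 H1 R13; WTile R13 H2 H1 R23; WTile R13 H1 H0 R0;
      WTile R23 H1 H0 R13; WTile R0 H1 H1 R23; WTile R23 H2 H0 R0].

(* Tiles are indexed by 'I_13; the 13 listed tiles are pairwise distinct. *)
Definition KC (i : 'I_13) : wtile := nth (WTile S0 H0 H0 S0) KC_list i.

Definition is_tiling (t : int -> int -> 'I_13) : Prop :=
  (forall x y : int, wright (KC (t x y)) = wleft (KC (t (x + 1)%R y))) /\
  (forall x y : int, wtop (KC (t x y)) = wbottom (KC (t x (y + 1)%R))).

Definition tiles_plane : Prop := exists t, is_tiling t.

Definition pattern (n : nat) := {ffun 'I_n * 'I_n -> 'I_13}.

Definition occurs (n : nat) (p : pattern n) : Prop :=
  exists t, is_tiling t /\ exists x0 y0 : int,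
    forall (a b : 'I_n), p (a, b) = t (x0 + (a : nat)%:Z)%R (y0 + (b : nat)%:Z)%R.

Definition C_T (n : nat) : nat := #|[set p : pattern n | `[< occurs p >]]|.

Definition entropy_seq (R : realType) (n : nat) : R :=
  (ln ((C_T n)%:R) / (n%:R ^+ 2))%R.

(* Main.v *)
Require Import Defs.
From HB Require Import structures.
From mathcomp Require Import all_boot all_order all_algebra.
From mathcomp Require Import all_classical all_reals all_analysis.
From mathcomp Require Import ring lra zify.
Import Order.TTheory GRing.Theory Num.Theory numFieldNormedType.Exports.
Local Open Scope ring_scope.
Local Open Scope classical_set_scope.

(* A row of slope x whose bottom digits are floor((j+1)x + r) - floor(jx + r)
   can be followed by the row of slope 2x (if 1/3 <= x < 1) or x/3 (if
   1 <= x < 2) with offset 2r or r/3, the s- and r-states being the carries; this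
   map is a bijection of [1/3, 2), so its orbits tile the plane.

   Entropy comes from the 2 x 2 block with bottom 1 1, left sides s_0, r_0, right
   sides s_1, r_0 and top 1 0, whose inner horizontal edges may read 2 1 or 1 2.
   Two such blocks never overlap, so they can be swapped independently.  When x
   stays away from 1/2 and 1, which happens at least once in every 5 rows, all
   the constraints on the block except the state r_0 hold with bounded gaps.  The
   state r_0 is a condition modulo 3, and the offset 2r of the next row may be
   replaced by 2r + c, which does not alter the digits; by pigeonhole some c
   makes at least a third of the candidates swappable.  Hence n x n windows with
   at least a constant times n^2 swappable blocks, while covering a square by
   smaller ones makes log C_T subadditive, so that the limit is an infimum. *)

(** * Tilings as edge colourings *)

Definition tile_ok (l : vcol) (b t : hcol) (r : vcol) : bool :=
  match l, b, t, r with
  | S0, H0, H0', S0 | S1, H0, H0', S1 | S0, H1, H2, S0 | S1, H1, H2, S1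
  | S0, H1, H1, S1 | S1, H0, H1, S0 | S1, H0', H1, S0
  | R0, H2, H1, R13 | R13, H2, H1, R23 | R13, H1, H0, R0
  | R23, H1, H0, R13 | R0, H1, H1, R23 | R23, H2, H0, R0 => true
  | _, _, _, _ => false
  end.

Lemma tile_okP l b t r : tile_ok l b t r -> exists i, KC i = WTile l b t r.
Proof.
by case: l; case: b => //; case: t => //; case: r => // _;
  [exists (@Ordinal 13 0 isT)|exists (@Ordinal 13 4 isT)
  |exists (@Ordinal 13 2 isT)|exists (@Ordinal 13 1 isT)
  |exists (@Ordinal 13 5 isT)|exists (@Ordinal 13 6 isT)
  |exists (@Ordinal 13 3 isT)|exists (@Ordinal 13 11 isT)
  |exists (@Ordinal 13 7 isT)|exists (@Ordinal 13 9 isT)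
  |exists (@Ordinal 13 8 isT)|exists (@Ordinal 13 10 isT)
  |exists (@Ordinal 13 12 isT)].
Qed.

(* [h x y] is the colour of the bottom edge of the cell [(x, y)], [v x y] that of its left edge. *)
Definition edge_valid (h : int -> int -> hcol) (v : int -> int -> vcol) :=
  forall x y, tile_ok (v x y) (h x y) (h x (y + 1)) (v (x + 1) y).

Lemma edge_valid_tiling h v : edge_valid h v ->
  exists t, is_tiling t /\
    forall x y, KC (t x y) = WTile (v x y) (h x y) (h x (y + 1)) (v (x + 1) y).
Proof.
move=> hv.
have /choice[t tP] (xy : int * int) := tile_okP _ _ _ _ (hv xy.1 xy.2).
exists (fun x y => t (x, y)); split; last by move=> x y; rewrite tP.
by split=> x y; rewrite !tP.
Qed.

(** * Independent swaps of 2 x 2 blocks *)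

Section Swap.
Variables (h : int -> int -> hcol) (v : int -> int -> vcol).

(* The boundary of a 2 x 2 block that has two different fillings: the lower row
   reads 21 or 12 on its top edge. *)
Definition swappable x y : Prop :=
  [/\ v x y = S0, v (x + 1 + 1) y = S1, h x y = H1, h (x + 1) y = H1
    & v x (y + 1) = R0].

Variable e : int -> int -> bool.

(** The bit of a block selects its filling: 2 1 with inner states s_0, r_{1/3} if true, 1 2 with
    s_1, r_{2/3} if false. Only the four inner edges are rewritten. *)
Definition swap_h x y : hcol :=
  if `[< swappable x (y - 1) >] then if e x (y - 1) then H2 else H1
  else if `[< swappable (x - 1) (y - 1) >]
       then if e (x - 1) (y - 1) then H1 else H2
  else h x y.

Definition swap_v x y : vcol :=
  if `[< swappable (x - 1) y >] then if e (x - 1) y then S0 else S1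
  else if `[< swappable (x - 1) (y - 1) >]
       then if e (x - 1) (y - 1) then R13 else R23
  else v x y.

Hypothesis hv : edge_valid h v.

(** The lower row must emit 21 or 12; read from r_0, either word emits 10 and returns to r_0. So the
    outer boundary is the same for both fillings. *)
Lemma swappable_block x y : swappable x y ->
  [/\ v (x + 1) y = S0 \/ v (x + 1) y = S1,
      v (x + 1) (y + 1) = R13 \/ v (x + 1) (y + 1) = R23,
      v (x + 1 + 1) (y + 1) = R0,
      h x (y + 1 + 1) = H1 & h (x + 1) (y + 1 + 1) = H0].
Proof.
move=> [v0 v2 h0 h1 r0].
have := hv x y; have := hv (x + 1) y.
have := hv x (y + 1); have := hv (x + 1) (y + 1).
rewrite v0 v2 h0 h1 r0.
case: (v (x + 1) y) => //; case: (h x (y + 1)) => //;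
case: (h (x + 1) (y + 1)) => //;
case: (v (x + 1) (y + 1)) => //; case: (h x (y + 1 + 1)) => //;
case: (h (x + 1) (y + 1 + 1)) => //; case: (v (x + 1 + 1) (y + 1)) => // *;
by split; auto.
Qed.

(** Each case is a position of the cell in a block. Blocks are disjoint: lower rows carry s-states,
    upper rows r-states, and the inner state of an upper row is never r_0. *)
Lemma swap_valid : edge_valid swap_h swap_v.
Proof.
move=> x y; rewrite /swap_h /swap_v !addrK.
have Ex : x - 1 + 1 = x by rewrite subrK.
have Ey : y - 1 + 1 = y by rewrite subrK.
have block a b (s : swappable a b) := conj s (swappable_block a b s).
case: (asboolP (swappable (x - 1) y)) => [B|nB].
  have [[b1 b2 b3 b4 b5] [b6 b7 b8 b9 b10]] := block _ _ B.
  rewrite ?Ex in b1 b2 b3 b4 b5 b6 b7 b8 b9 b10.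
  case: (asboolP (swappable x (y - 1))) => [C|nC].
    have [[c1 c2 c3 c4 c5] _] := block _ _ C.
    by rewrite !Ey in c5; case: b6; rewrite c5.
  case: (asboolP (swappable (x - 1) (y - 1))) => [D|nD].
    have [[d1 d2 d3 d4 d5] _] := block _ _ D.
    by rewrite !Ey b1 in d5.
  case: (asboolP (swappable x y)) => [A|nA].
    have [[a1 a2 a3 a4 a5] _] := block _ _ A.
    by case: b7; rewrite a5.
  by rewrite b2 b4; case: e.
case: (asboolP (swappable x (y - 1))) => [C|nC].
  have [[c1 c2 c3 c4 c5] [c6 c7 c8 c9 c10]] := block _ _ C.
  rewrite ?Ey in c1 c2 c3 c4 c5 c6 c7 c8 c9 c10.
  case: (asboolP (swappable (x - 1) (y - 1))) => [D|nD].
    have [_ [d6 d7 d8 d9 d10]] := block _ _ D.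
    by rewrite !Ex !Ey c5 in d7; case: d7.
  case: (asboolP (swappable x y)) => [A|nA].
    have [[a1 a2 a3 a4 a5] _] := block _ _ A.
    by rewrite a1 in c5.
  by rewrite c5 c9; case: e.
case: (asboolP (swappable (x - 1) (y - 1))) => [D|nD].
  have [_ [d6 d7 d8 d9 d10]] := block _ _ D.
  rewrite ?Ex ?Ey in d6 d7 d8 d9 d10.
  case: (asboolP (swappable x y)) => [A|nA].
    have [[a1 a2 a3 a4 a5] _] := block _ _ A.
    by rewrite a1 in d7; case: d7.
  by rewrite d8 d10; case: e.
case: (asboolP (swappable x y)) => [A|nA]; last exact: hv.
have [[a1 a2 a3 a4 a5] _] := block _ _ A.
by rewrite a1 a3; case: e.
Qed.

Lemma swap_h_swappable x y : swappable x y ->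
  swap_h x (y + 1) = if e x y then H2 else H1.
Proof. by move=> s; rewrite /swap_h addrK asboolT. Qed.

End Swap.

(** * Bounds on the number of patterns *)

Lemma occurs_restrict t n : is_tiling t ->
  occurs ([ffun ab : 'I_n * 'I_n => t (ab.1 : nat)%:Z (ab.2 : nat)%:Z] : pattern n).
Proof.
by move=> tt; exists t; split=> //; exists 0, 0 => a b; rewrite ffunE !add0r.
Qed.

(** The bit of a block is visible on the top edge of its lower left cell, so only that cell has to
    lie in the window. *)
Lemma swappable_count h v n (D : {set 'I_n * 'I_n}) : edge_valid h v ->
  (forall ab, ab \in D -> swappable h v (ab.1 : nat)%:Z (ab.2 : nat)%:Z) ->
  (2 ^ #|D| <= C_T n)%N.
Proof.
move=> hv sD.
pose e (E : {set 'I_n * 'I_n}) (x y : int) : bool :=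
  [exists ab in E, (x == (ab.1 : nat)%:Z) && (y == (ab.2 : nat)%:Z)].
have eE E (ab : 'I_n * 'I_n) : e E (ab.1 : nat)%:Z (ab.2 : nat)%:Z = (ab \in E).
  apply/exists_inP/idP => [[cd cdE /andP[]]|abE]; last by exists ab; rewrite ?eqxx.
  rewrite !eqz_nat => /eqP /val_inj e1 /eqP /val_inj e2.
  by rewrite (_ : ab = cd)//; case: ab cd e1 e2 {cdE} => ? ? [? ?] /= -> ->.
have /choice[t tP] E := edge_valid_tiling _ _ (swap_valid h v (e E) hv).
pose f E : pattern n :=
  [ffun ab : 'I_n * 'I_n => t E (ab.1 : nat)%:Z (ab.2 : nat)%:Z].
rewrite -card_powerset -(@card_in_imset _ _ f).
  apply/subset_leq_card/fintype.subsetP => _ /imsetP[E _ ->].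
  by rewrite inE; apply/asboolP; apply: occurs_restrict; have [] := tP E.
have fE E (ab : 'I_n * 'I_n) : ab \in D ->
    wtop (KC (f E ab)) = if ab \in E then H2 else H1.
  move=> abD; rewrite ffunE; have [_ ->] := tP E.
  by rewrite /= swap_h_swappable ?eE//; exact: sD.
move=> E F /[!powersetE] /fintype.subsetP ED /fintype.subsetP FD EF; apply/setP => ab.
have [abD|abD] := boolP (ab \in D).
  have := fE E ab abD; rewrite EF fE//.
  by case: (ab \in E); case: (ab \in F).
by rewrite (negbTE (contraNN (ED ab) abD)) (negbTE (contraNN (FD ab) abD)).
Qed.

(** A pattern is recovered from q * q squares of side m covering it. They may stick out of the
    window, so they are cut from one tiling fixed for each pattern. *)
Lemma C_T_cover m n q : (0 < m)%N -> (n <= q * m)%N ->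
  (C_T n <= C_T m ^ (q * q))%N.
Proof.
move=> m0 nqm.
have /choice[t tP] (p : pattern n) : exists t : int -> int -> 'I_13, occurs p ->
    is_tiling t /\ forall a b : 'I_n, p (a, b) = t (a : nat)%:Z (b : nat)%:Z.
  have [[t [tt [x0 [y0 pt]]]]|?] := pselect (occurs p); last first.
    by exists (fun _ _ => ord0).
  exists (fun x y => t (x0 + x) (y0 + y)) => _; split=> //.
  by split=> x y; rewrite addrA; [apply: tt.1|apply: tt.2].
pose f (p : pattern n) : {ffun 'I_q * 'I_q -> pattern m} :=
  [ffun ij : 'I_q * 'I_q => [ffun ab : 'I_m * 'I_m =>
     t p (ij.1 * m + ab.1)%N%:Z (ij.2 * m + ab.2)%N%:Z]].
have fC p : occurs p ->
    f p \in ffun_on [set p : pattern m | `[< occurs p >]]%SET.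
  move=> op; apply/ffun_onP => ij; rewrite inE; apply/asboolP.
  exists (t p); split; first exact: (tP _ op).1.
  exists (ij.1 * m)%N%:Z, (ij.2 * m)%N%:Z => a b.
  by rewrite !ffunE !PoszD.
have -> : (C_T m ^ (q * q))%N =
    #|@ffun_on ('I_q * 'I_q)%type [set p : pattern m | `[< occurs p >]]%SET|.
  by rewrite card_ffun_on card_prod card_ord.
rewrite {1}/C_T -(@card_in_imset _ _ f).
  apply/subset_leq_card/fintype.subsetP => _ /imsetP[p pC ->].
  by apply: fC; move: pC; rewrite !inE.
move=> p p'; rewrite !inE => op op' ff; apply/ffunP => -[a b].
rewrite (tP _ op).2 (tP _ op').2.
have qm (i : 'I_n) : (i %/ m < q)%N.
  by rewrite ltn_divLR//; exact: leq_trans (ltn_ord i) nqm.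
have mm (i : 'I_n) : (i %% m < m)%N by rewrite ltn_mod.
have := congr1 (fun g : {ffun 'I_q * 'I_q -> pattern m} =>
  g (Ordinal (qm a), Ordinal (qm b)) (Ordinal (mm a), Ordinal (mm b))) ff.
by rewrite !ffunE /= -!divn_eq.
Qed.

(** * A Fekete lemma for squares *)

Lemma square_subadditive_cvg (R : realType) (a : nat -> R) :
  (forall n, 0 <= a n) ->
  (forall m n q, (0 < m)%N -> (n <= q * m)%N -> a n <= (q%:R ^+ 2) * a m) ->
  (fun n => a n / n%:R ^+ 2) @ \oo --> inf [set a n / n%:R ^+ 2 | n in [set n | (0 < n)%N]].
Proof.
move=> a0 asub; set A := [set _ | _ in _]; set l := inf A.
have u0 n : 0 <= a n / n%:R ^+ 2 by rewrite divr_ge0// exprn_ge0.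
have A0 : has_inf A.
  split; first by exists (a 1%N / 1%:R ^+ 2), 1%N.
  by exists 0 => _ [n _ <-].
have lA n : (0 < n)%N -> l <= a n / n%:R ^+ 2.
  by move=> n0; apply: ge_inf; [case: A0|exists n].
have l0 : 0 <= l by apply: lb_le_inf; [case: A0|move=> _ [n _ <-]].
apply/cvgrPdist_le => /= e e0.
have [_ [m /= m0 <-] lm] : exists2 x, A x & x < l + e / 2.
  by apply: inf_adherent => //; rewrite divr_gt0.
set u := a m / m%:R ^+ 2 in lm.
have mR : 0 < m%:R :> R by rewrite ltr0n.
near=> n.
have n0 : (0 < n)%N by near: n; exists 1%N.
have nR : 0 < n%:R :> R by rewrite ltr0n.
rewrite ler0_norm ?subr_le0 ?lA// opprB lerBlDr.
pose q := (n %/ m).+1.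
have qn : (n <= q * m)%N by rewrite ltnW// ltn_ceil.
have qm : q%:R * m%:R <= n%:R + m%:R :> R.
  by rewrite -natrM -natrD ler_nat mulSn addnC leq_add2r leq_trunc_div.
(* The cover costs u (n + m)^2, and 2mn + m^2 <= (2m + m^2) n; for such n this excess is at most (e
   / 2) n^2. *)
have un : 2 * (u * (2 * m%:R + m%:R ^+ 2)) / e <= n%:R.
  near: n; exists (Num.bound (2 * (u * (2 * m%:R + m%:R ^+ 2)) / e)) => // k /=.
  move=> bk; apply/ltW; apply: lt_le_trans (archi_boundP _) _; last by rewrite ler_nat.
  by rewrite !(divr_ge0, mulr_ge0, addr_ge0)// ?exprn_ge0 ?ltW.
rewrite ler_pdivrMr in un => //.
rewrite ler_pdivrMr ?exprn_gt0//.
apply: le_trans (asub _ _ _ m0 qn) _.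
have -> : a m = u * m%:R ^+ 2 by rewrite /u divfK// expf_neq0// gt_eqF.
have uu : 0 <= u by apply: u0.
have h1 : q%:R ^+ 2 * (u * m%:R ^+ 2) <= u * (n%:R + m%:R) ^+ 2.
  rewrite mulrCA -exprMn ler_wpM2l// lerXn2r// nnegrE.
  by rewrite mulr_ge0. by rewrite addr_ge0 ?ltW.
apply: le_trans h1 _.
have n1 : 1 <= n%:R :> R by rewrite ler1n.
have h2 : u * (n%:R + m%:R) ^+ 2 <= u * n%:R ^+ 2 + u * (2 * m%:R + m%:R ^+ 2) * n%:R.
  have : 0 <= u * m%:R ^+ 2 * (n%:R - 1).
    by rewrite mulr_ge0 ?subr_ge0// mulr_ge0// exprn_ge0// ltW.
  by rewrite !expr2; nra.
apply: le_trans h2 _.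
have h3 : u * n%:R ^+ 2 <= (l + e / 2) * n%:R ^+ 2.
  by rewrite ler_wpM2r ?exprn_ge0// ltW.
have h4 : u * (2 * m%:R + m%:R ^+ 2) * n%:R <= (n%:R * e / 2) * n%:R.
  rewrite ler_wpM2r ?(ltW nR)//; lra.
lra.
Unshelve. all: by end_near.
Qed.

(** * Cells between rows of slopes x and 2x or x / 3 *)

(* The colour of the digit [d] on a bottom edge of a row of slope [x]: the row
   below multiplies by 2 exactly when [2 / 3 <= x], and then its 0's are primed. *)
Definition row_color (x : rat) (d : int) : hcol :=
  if d == 0 then if x < 2 / 3 then H0 else H0'
  else if d == 1 then H1 else H2.

(** Here y is the value at the left edge. The carry floor(2y) - 2 floor(y) is 1 in s_0 and 0 in s_1;
    the residue i of floor(y) modulo 3 gives r_{(2 - i) / 3}. *)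
Definition row_state (x y : rat) : vcol :=
  if x < 1 then
    if Num.floor (2 * y) == 2 * Num.floor y then S1 else S0
  else if (Num.floor y %% 3)%Z == 2 then R0
  else if (Num.floor y %% 3)%Z == 1 then R13 else R23.

Definition floor_diff (x y : rat) : int := Num.floor (y + x) - Num.floor y.

Lemma floor_bounds (y : rat) : (Num.floor y)%:~R <= y < (Num.floor y)%:~R + 1.
Proof. by have := floor_itv y; rewrite intrD. Qed.

Lemma floorD_intr (y : rat) (c : int) : Num.floor (y + c%:~R) = Num.floor y + c.
Proof.
by apply: floor_def; have := floor_bounds y; rewrite !intrD /=; lra.
Qed.

Lemma ltr_int_rat (a b : int) : (a%:~R : rat) < b%:~R -> a < b.
Proof. by rewrite ltr_int. Qed.

Lemma int_eq_or_succ (a b : int) : a < b + 1 -> b < a + 2 -> b = a \/ b = a + 1.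
Proof. lia. Qed.

(** The three pairs i < j and the three pairs j < i are the six r-tiles, with top digit B - A equal
    to 0 and 1 respectively. *)
Lemma third_carry (a b A B : int) :
  3 * A < a + 1 -> a < 3 * A + 3 -> 3 * B < b + 1 -> b < 3 * B + 3 ->
  a < b -> b < a + 3 ->
  exists i j : 'I_3, [/\ a = 3 * A + (i : nat)%:Z, b = 3 * B + (j : nat)%:Z
    & (A = B /\ (i < j)%N) \/ (B = A + 1 /\ (j < i)%N)].
Proof.
move=> h1 h2 h3 h4 h5 h6.
have ia : (`|(a - 3 * A)%R|%N < 3)%N by lia.
have ib : (`|(b - 3 * B)%R|%N < 3)%N by lia.
exists (Ordinal ia), (Ordinal ib) => /=; split; lia.
Qed.

Lemma modz3D (A : int) (i : 'I_3) : ((3 * A + (i : nat)%:Z) %% 3)%Z = (i : nat)%:Z.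
Proof. by rewrite mulrC modzMDl modz_small//; case: i => i /=; lia. Qed.

Lemma double_cell_ok (x y z : rat) : 1 / 3 <= x < 1 ->
  (exists c : int, z = 2 * y + c%:~R) ->
  tile_ok (row_state x y) (row_color x (floor_diff x y))
    (row_color (2 * x) (floor_diff (2 * x) z)) (row_state x (y + x)).
Proof.
move=> /andP[x0 x1] [c ->].
have -> : floor_diff (2 * x) (2 * y + c%:~R) = floor_diff (2 * x) (2 * y).
  rewrite /floor_diff (_ : _ + _ + 2 * x = 2 * y + 2 * x + c%:~R); last by ring.
  by rewrite !floorD_intr; ring.
rewrite /floor_diff -mulrDr /row_state x1.
have /andP[] := floor_bounds y; have /andP[] := floor_bounds (y + x).
have /andP[] := floor_bounds (2 * y); have /andP[] := floor_bounds (2 * (y + x)).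
set a := Num.floor y; set b := Num.floor (y + x).
set A := Num.floor (2 * y); set B := Num.floor (2 * (y + x)).
move=> B1 B2 A1 A2 b1 b2 a1 a2.
have hb : b = a \/ b = a + 1.
  by apply: int_eq_or_succ; apply: ltr_int_rat; rewrite intrD /=; lra.
have hA : A = 2 * a \/ A = 2 * a + 1.
  by apply: int_eq_or_succ; apply: ltr_int_rat; rewrite intrD intrM /=; lra.
have hB : B = 2 * b \/ B = 2 * b + 1.
  by apply: int_eq_or_succ; apply: ltr_int_rat; rewrite intrD intrM /=; lra.
have Ea : (2 * a + 1 == 2 * a) = false by rewrite -subr_eq0 addrAC subrr.
have Eb : (2 * b + 1 == 2 * b) = false by rewrite -subr_eq0 addrAC subrr.
have Et : (2 * x < 2 / 3) = false by lra.
move: A1 A2 B1 B2 b1 b2.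
case: hA => ->; case: hB => ->; case: hb => hb; rewrite ?Ea ?Eb ?eqxx;
  rewrite hb ?intrD ?intrM /= => A1 A2 B1 B2 b1 b2; rewrite /row_color Et.
all: have d1 : a + 1 - a = 1 by ring.
all: have d2 : 2 * (a + 1) - 2 * a = 2 by ring.
all: have d3 : 2 * a + 1 - 2 * a = 1 by ring.
all: have d4 : 2 * (a + 1) - (2 * a + 1) = 1 by ring.
all: have d5 : 2 * (a + 1) + 1 - (2 * a + 1) = 2 by ring.
all: rewrite ?d1 ?d2 ?d3 ?d4 ?d5 ?subrr //=.
all: try by case: (x < 2 / 3).
all: try (exfalso; lra).
(* Both digits are 0 in the remaining cells, so 2x < 1 and the lower 0 is unprimed. *)
all: by rewrite (_ : (x < 2 / 3) = true)//; lra.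
Qed.

Lemma third_cell_ok (x y : rat) : 1 <= x < 2 ->
  tile_ok (row_state x y) (row_color x (floor_diff x y))
    (row_color (x / 3) (floor_diff (x / 3) (y / 3))) (row_state x (y + x)).
Proof.
move=> /andP[x0 x1].
have xn : (x < 1) = false by apply/negbTE; rewrite -leNgt.
rewrite /floor_diff -mulrDl /row_state xn.
have /andP[] := floor_bounds y; have /andP[] := floor_bounds (y + x).
have /andP[] := floor_bounds (y / 3); have /andP[] := floor_bounds ((y + x) / 3).
set a := Num.floor y; set b := Num.floor (y + x).
set A := Num.floor (y / 3); set B := Num.floor ((y + x) / 3).
move=> B1 B2 A1 A2 b1 b2 a1 a2.
have Et : (x / 3 < 2 / 3) = true by lra.
have [i [j [ai bj h]]] : exists i j : 'I_3, [/\ a = 3 * A + (i : nat)%:Z,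
    b = 3 * B + (j : nat)%:Z & (A = B /\ (i < j)%N) \/ (B = A + 1 /\ (j < i)%N)].
  by apply: third_carry; apply: ltr_int_rat; rewrite ?intrD ?intrM /=; lra.
have hd d : B = A + d -> B - A = d by move=> ->; rewrite addrC addKr.
have -> : b - a = 3 * (B - A) + ((j : nat)%:Z - (i : nat)%:Z) by rewrite ai bj; ring.
rewrite /row_color Et {1 2}ai {1 2}bj !modz3D.
case: h => -[BA ij]; last first.
  rewrite (hd _ BA).
  by case: i j ij {ai bj} => -[|[|[|]]]// ? [[|[|[|]]]// ?].
rewrite BA subrr.
by case: i j ij {ai bj} => -[|[|[|]]]// ? [[|[|[|]]]// ?].
Qed.

(** * Two-sided sequences of rows *)

Definition row_point (s : rat * rat) (j : int) : rat := j%:~R * s.1 + s.2.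

Lemma row_pointS s j : row_point s (j + 1) = row_point s j + s.1.
Proof. by rewrite /row_point intrD /=; ring. Qed.

(* Digits depend on the offset modulo 1 only, whence the free integer [c]. *)
Definition successor_row (s s' : rat * rat) : Prop :=
  (1 / 3 <= s.1 < 1 /\ s'.1 = 2 * s.1 /\ exists c : int, s'.2 = 2 * s.2 + c%:~R)
  \/ (1 <= s.1 < 2 /\ s'.1 = s.1 / 3 /\ s'.2 = s.2 / 3).

Definition row_h (s : int -> rat * rat) (j k : int) : hcol :=
  row_color (s k).1 (floor_diff (s k).1 (row_point (s k) j)).

Definition row_v (s : int -> rat * rat) (j k : int) : vcol :=
  row_state (s k).1 (row_point (s k) j).

Lemma rows_valid (s : int -> rat * rat) :
  (forall k, successor_row (s k) (s (k + 1))) -> edge_valid (row_h s) (row_v s).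
Proof.
move=> ss j k; rewrite /row_h /row_v row_pointS.
have [[xk [-> [c pk]]]|[xk [xE pk]]] := ss k.
  apply: double_cell_ok => //; exists c.
  rewrite /row_point pk; have [[_ [-> _]]|[]] := ss k; [ring|lra].
have -> : row_point (s (k + 1)) j = row_point (s k) j / 3 by rewrite /row_point xE pk; ring.
by rewrite xE; exact: third_cell_ok.
Qed.

(** The last clause matters because [step] will choose offsets favourable to swaps, which the
    relation [L] alone would forget. *)
Lemma two_sided_orbit {S : Type} (I : S -> Prop) (L : S -> S -> Prop)
    (step back : S -> S) (s0 : S) : I s0 ->
  (forall s, I s -> I (step s) /\ L s (step s)) ->
  (forall s, I s -> I (back s) /\ L (back s) s) ->
  exists s : int -> S, (forall k, I (s k)) /\ (forall k, L (s k) (s (k + 1))) /\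
    forall n : nat, s n.+1%:Z = step (s n%:Z).
Proof.
move=> I0 hstep hback.
pose s (k : int) := match k with
  | Posz n => iter n step s0 | Negz n => iter n.+1 back s0 end.
have If n : I (iter n step s0) by elim: n => //= n /hstep[].
have Ib n : I (iter n back s0) by elim: n => //= n /hback[].
exists s; split; first by case=> n; [exact: If|exact: Ib].
split=> // -[n|[|n]].
- by rewrite -PoszD addn1; exact: (hstep _ (If n)).2.
- exact: (hback _ I0).2.
- rewrite (_ : Negz n.+1 + 1 = Negz n); first exact: (hback _ (Ib n.+1)).2.
  by rewrite !NegzE; lia.
Qed.

Definition slope_ok (s : rat * rat) : Prop := 1 / 3 <= s.1 < 2.

Lemma successor_row_slope_ok s s' : successor_row s s' -> slope_ok s'.
Proof. by rewrite /slope_ok => -[[xs [-> _]]|[xs [-> _]]]; lra. Qed.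

(** Doubling maps [1/3, 1) onto [2/3, 2) and division by 3 maps [1, 2) onto [1/3, 2/3). *)
Lemma predecessor_row s : slope_ok s -> exists s', slope_ok s' /\ successor_row s' s.
Proof.
rewrite /slope_ok => xs; have [x23|x23] := lerP (2 / 3) s.1.
  exists (s.1 / 2, s.2 / 2); split=> /=; first lra.
  left; split=> /=; first lra.
  by split; [lra|exists 0; rewrite addr0; lra].
exists (s.1 * 3, s.2 * 3); split=> /=; first lra.
by right; split=> /=; [lra|split; lra].
Qed.

(** * Density of swappable blocks *)

(* Slopes for which swappable blocks have bounded gaps. *)
Definition flexible_slope (x : rat) : bool := 11 / 20 <= x <= 19 / 20.

(** A slope in [1, 2) drops below 2/3 in one step; one below 11/20 doubles into [2/3, 11/10); from
    (19/20, 11/10) two more steps multiply by 2/3 and land in the flexible range. *)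
Lemma flexible_row (s : nat -> rat * rat) :
  (forall k, successor_row (s k) (s k.+1)) ->
  forall k, exists2 i, (i < 5)%N & flexible_slope (s (k + i)%N).1.
Proof.
move=> ss k.
have [f|n0] := boolP (flexible_slope (s k).1); first by exists 0%N; rewrite ?addn0.
have [f|n1] := boolP (flexible_slope (s k.+1).1); first by exists 1%N; rewrite ?addn1.
have [f|n2] := boolP (flexible_slope (s k.+2).1); first by exists 2%N; rewrite ?addn2.
have [f|n3] := boolP (flexible_slope (s k.+3).1); first by exists 3%N; rewrite ?addn3.
exists 4%N; [by []|rewrite addn4]; move: n0 n1 n2 n3; rewrite /flexible_slope.
have := ss k; have := ss k.+1; have := ss k.+2; have := ss k.+3.
rewrite /successor_row.
move: (s k).1 (s k.+1).1 (s k.+2).1 (s k.+3).1 (s k.+4).1 => x0 x1 x2 x3 x4.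
rewrite !negb_and -!ltNge => e3 e2 e1 e0 /orP n0 /orP n1 /orP n2 /orP n3.
case: e0 => -[h0 [E0 _]]; case: n0 => n0; try (exfalso; lra);
case: e1 => -[h1 [E1 _]]; try (exfalso; lra);
case: n1 => n1; try (exfalso; lra);
case: e2 => -[h2 [E2 _]]; try (exfalso; lra);
case: n2 => n2; try (exfalso; lra);
case: e3 => -[h3 [E3 _]]; try (exfalso; lra);
case: n3 => n3; try (exfalso; lra); lra.
Qed.

(** Steps of length d cannot jump over an interval [m - d, m), and the next integer m is at distance
    at most 1 <= 20 d. *)
Lemma arithmetic_progression_hits (a d : rat) : 1 / 20 <= d <= 1 / 2 ->
  exists2 i : nat, (i <= 20)%N & exists m : int, m%:~R - d <= a + i%:R * d < m%:~R.
Proof.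
move=> /andP[d0 d1]; have /andP[a0 a1] := floor_bounds a.
set m := Num.floor a + 1.
have mE : m%:~R = (Num.floor a)%:~R + 1 :> rat by rewrite intrD.
have dp : 0 < d by lra.
pose q := (m%:~R - a) / d.
have qE : q * d = m%:~R - a by rewrite divfK// gt_eqF.
have q0 : 0 < q by rewrite divr_gt0//; lra.
have q20 : q <= 20 by rewrite ler_pdivrMr//; lra.
have /andP[c0 c1] := ceil_itv q.
have c2 : 0 < Num.ceil q by rewrite -ceil_gt0 in q0 *.
have c3 : Num.ceil q <= 20 by rewrite ceil_le_int.
exists `|Num.ceil q - 1|%N; first lia.
exists m.
have -> : (`|Num.ceil q - 1|%N)%:R = (Num.ceil q)%:~R - 1 :> rat.
  by rewrite natr_absz ger0_norm ?intrD//; lia.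
rewrite intrD /= in c0.
nra.
Qed.

(** The first two bounds put y in [a + 1/2, a + 1), which is state s_0; the last two put y + 2x in
    [a + 2, a + 5/2), which is state s_1 after digits of sum 2. *)
Definition flexible_point (x y : rat) (a : int) : Prop :=
  [/\ 1 / 2 <= y - a%:~R, y - a%:~R < 1, 2 - 2 * x <= y - a%:~R
    & y - a%:~R < 5 / 2 - 2 * x].

(* For [3 / 4 <= x] the fractional part decreases by [1 - x] at each step; for
   [x < 3 / 4] it increases by [2 * x - 1] every other step. *)
Lemma flexible_point_gap (x y : rat) : flexible_slope x ->
  exists2 j : nat, (j <= 40)%N & exists a, flexible_point x (y + j%:R * x) a.
Proof.
move=> /andP[x0 x1]; have [x34|x34] := lerP (3 / 4) x.
  have [|j j20 [m jm]] := arithmetic_progression_hits (1 / 2 - y) (1 - x); first lra.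
  exists j; first lia.
  exists (j%:Z - m); rewrite /flexible_point intrD mulrNz /=.
  rewrite -[(j%:Z)%:~R]/(j%:R).
  by move: (j%:R) jm => u jm; split; lra.
have [|i i20 [m im]] := arithmetic_progression_hits y (2 * x - 1); first lra.
exists (2 * i)%N; first lia.
exists (m - 1 + i%:Z); rewrite /flexible_point !intrD natrM /=.
rewrite -[(i%:Z)%:~R]/(i%:R).
by move: (i%:R) im => u im; split; lra.
Qed.

Lemma flexible_point_floors (x y : rat) a : flexible_slope x ->
  flexible_point x y a ->
  [/\ row_state x y = S0, row_state x (y + x + x) = S1,
      floor_diff x y = 1, floor_diff x (y + x) = 1
    & Num.floor (2 * y) = 2 * a + 1].
Proof.
move=> /andP[x0 x1] [y1 y2 y3 y4].
have x1' : x < 1 by lra.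
have f0 : Num.floor y = a by apply: floor_def; rewrite intrD /=; lra.
have f1 : Num.floor (y + x) = a + 1 by apply: floor_def; rewrite !intrD /=; lra.
have f2 : Num.floor (y + x + x) = a + 2 by apply: floor_def; rewrite !intrD /=; lra.
have g0 : Num.floor (2 * y) = 2 * a + 1.
  by apply: floor_def; rewrite !intrD intrM /=; lra.
have g2 : Num.floor (2 * (y + x + x)) = 2 * a + 4.
  by apply: floor_def; rewrite !intrD intrM /=; lra.
rewrite /row_state /floor_diff x1' f0 f1 f2 g0 g2; split; last reflexivity.
- by rewrite -subr_eq0 addrAC subrr.
- by rewrite (_ : 2 * (a + 2) = 2 * a + 4) ?eqxx; [|ring].
- by rewrite addrC addKr.
- by rewrite opprD addrACA subrr.
Qed.

Lemma pigeonhole3 M (f : 'I_(3 * M) -> 'I_3) :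
  exists c, exists2 g : 'I_M -> 'I_(3 * M), injective g & forall i, f (g i) = c.
Proof.
have [c Mc] : exists c, (M <= #|[pred i | f i == c]|)%N.
  apply/existsP; apply: contraT; rewrite negb_exists => /forallP lt.
  have : (\sum_(c : 'I_3) #|[pred i | f i == c]| = 3 * M)%N.
    rewrite -[RHS]card_ord -sum1_card (partition_big f xpredT)//=.
    by apply: eq_bigr => c _; rewrite -sum1_card; apply: eq_bigl => i; rewrite inE.
  rewrite !big_ord_recl big_ord0.
  have := lt ord0; have := lt (lift ord0 ord0); have := lt (lift ord0 (lift ord0 ord0)).
  rewrite -!ltnNge; lia.
exists c, (fun i => enum_val (widen_ord Mc i)).
  by move=> i j /enum_val_inj /(congr1 val) /= /val_inj.
by move=> i; have := enum_valP (widen_ord Mc i); rewrite inE => /eqP.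
Qed.

Definition swappable_rows (s s' : rat * rat) (j : int) : Prop :=
  [/\ row_state s.1 (row_point s j) = S0, row_state s.1 (row_point s (j + 1 + 1)) = S1,
      floor_diff s.1 (row_point s j) = 1, floor_diff s.1 (row_point s (j + 1)) = 1
    & row_state s'.1 (row_point s' j) = R0].

(** Each of 3M consecutive intervals of 41 columns supplies a candidate, and one offset c suits at
    least M of them. *)
Lemma flexible_step M s : slope_ok s -> exists s', successor_row s s' /\
  (flexible_slope s.1 -> exists2 g : 'I_M -> nat, injective g &
     forall i, (g i < 123 * M)%N /\ swappable_rows s s' (g i)%:Z).
Proof.
move=> xs; have [fx|nf] := boolP (flexible_slope s.1); last first.
  have [x1|x1] := ltrP s.1 1.
    exists (2 * s.1, 2 * s.2); split=> //; left; rewrite /slope_ok in xs *.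
    by split=> /=; [lra|split=> //; exists 0; rewrite addr0].
  exists (s.1 / 3, s.2 / 3); split=> //; right; rewrite /slope_ok in xs *.
  by split=> /=; [lra|].
have /choice[u uP] (i : 'I_(3 * M)) : exists ja : nat * int, (ja.1 <= 40)%N /\
    flexible_point s.1 (row_point s (41 * i + ja.1)%N%:Z) ja.2.
  have [j j40 [a ja]] := flexible_point_gap s.1 (row_point s (41 * i)%N%:Z) fx.
  exists (j, a); split; [exact: j40|move: ja].
  rewrite (_ : _ + j%:R * s.1 = row_point s (41 * i + j)%N%:Z)//.
  by rewrite /row_point PoszD intrD /=; ring.
(* State r_0 requires 2a + 1 + c = 2 modulo 3, that is c = 1 + a modulo 3. *)
have c3 (a : int) : (`|((1 + a) %% 3)%Z|%N < 3)%N by lia.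
have [c [g ginj gc]] := pigeonhole3 M (fun i => Ordinal (c3 (u i).2)).
exists (2 * s.1, 2 * s.2 + (c : nat)%:R); split.
  left; move/andP: fx => [f0 f1]; split=> /=; first lra.
  by split=> //; exists (c : nat)%:Z.
move=> _; exists (fun i => (41 * g i + (u (g i)).1)%N).
  move=> i j ij; apply: ginj; apply: val_inj => /=.
  have := (uP (g i)).1; have := (uP (g j)).1; lia.
move=> i; have [j40 fj] := uP (g i); split.
  by have := ltn_ord (g i); lia.
have [p1 p2 p3 p4 p5] := flexible_point_floors _ _ _ fx fj.
split; rewrite ?row_pointS; [exact: p1|exact: p2|exact: p3|exact: p4|].
set y := row_point s _ in p5.
have -> : row_point (2 * s.1, 2 * s.2 + c%:R) (41 * g i + (u (g i)).1)%N%:Z =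
    2 * y + (c : nat)%:Z%:~R by rewrite /y /row_point /=; ring.
move: fx => /andP[f0 f1].
rewrite /row_state /= ifF; last by apply/negbTE; rewrite -leNgt; lra.
rewrite floorD_intr p5.
have := congr1 val (gc i) => /= <-.
rewrite ifT//; lia.
Qed.

(* [615 = 5 * 123]: one flexible row in every 5, and [M] usable blocks among the
   first [123 * M = 3 * 41 * M] columns of each. *)
Lemma swappable_lower_bound M : (2 ^ (M * M) <= C_T (615 * M))%N.
Proof.
have /choice[st stP] (s : rat * rat) : exists s', slope_ok s -> successor_row s s' /\
  (flexible_slope s.1 -> exists2 g : 'I_M -> nat, injective g &
     forall i, (g i < 123 * M)%N /\ swappable_rows s s' (g i)%:Z).
  by have [/(flexible_step M)[s']|] := pselect (slope_ok s); [exists s'|exists s].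
have /choice[bk bkP] (s : rat * rat) : exists s', slope_ok s ->
    slope_ok s' /\ successor_row s' s.
  by have [/predecessor_row[s']|] := pselect (slope_ok s); [exists s'|exists s].
have [|||s [sok [slink sS]]] := two_sided_orbit slope_ok successor_row st bk (1, 0).
- by rewrite /slope_ok /=; lra.
- by move=> s /stP[ss _]; split=> //; exact: successor_row_slope_ok ss.
- by move=> s /bkP.
have sv := rows_valid _ slink.
have /choice[k kP] (r : 'I_M) : exists k : nat, [/\ (5 * r <= k)%N, (k < 5 * r + 5)%N
    & flexible_slope (s k%:Z).1].
  have [|i i5 fi] := flexible_row (fun n => s n%:Z) _ (5 * r)%N.
    by move=> n; have := slink n%:Z; rewrite -PoszD addn1.
  by exists (5 * r + i)%N; split=> //; lia.
have /choice[g gP] (r : 'I_M) : exists g : 'I_M -> nat, injective g /\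
     forall i, (g i < 123 * M)%N /\ swappable_rows (s (k r)%:Z) (s (k r).+1%:Z) (g i)%:Z.
  have [_ _ fk] := kP r; rewrite sS.
  by have [_ /(_ fk)[g gi gP]] := stP _ (sok (k r)%:Z); exists g.
have gn r i : (g r i < 615 * M)%N by have [_ /(_ i)[]] := gP r; lia.
have kn r : (k r < 615 * M)%N by have [_ ? _] := kP r; have := ltn_ord r; lia.
pose p (ri : 'I_M * 'I_M) := (Ordinal (gn ri.1 ri.2), Ordinal (kn ri.1)).
have pinj : injective p.
  move=> [r i] [r' i'] [gg kk].
  have rr : r = r'.
    by apply: val_inj => /=; have [? ? _] := kP r; have [? ? _] := kP r'; lia.
  by rewrite -rr in gg *; rewrite ((gP r).1 _ _ gg).
have -> : (M * M = #|p @: [set: 'I_M * 'I_M]%SET|)%N.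
  by rewrite card_imset// cardsT card_prod card_ord.
apply: (swappable_count _ _ _ _ sv) => _ /imsetP[[r i] _ ->] /=.
have [_ /(_ i)[_ [p1 p2 p3 p4 p5]]] := gP r.
rewrite /swappable /row_v /row_h p3 p4.
by split=> //; rewrite -PoszD addn1.
Qed.

(** * Existence of tilings and positive entropy *)

Lemma C_T_gt0 n : (0 < C_T n)%N.
Proof.
case: n => [|n].
  have := swappable_lower_bound 0; rewrite !muln0; lia.
rewrite lt0n; apply/eqP => C0.
have := leq_trans (swappable_lower_bound n.+1)
  (C_T_cover n.+1 (615 * n.+1)%N 615 isT (leqnn _)).
by rewrite C0 exp0n ?muln_gt0// leqNgt expn_gt0.
Qed.

(** Even the empty pattern occurs only if there is a tiling. *)
Lemma KC_tiles_plane : tiles_plane.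
Proof.
have : (0 < C_T 0)%N := C_T_gt0 0.
rewrite /C_T card_gt0 => /set0Pn[p]; rewrite inE => /asboolP[t [tt _]].
by exists t.
Qed.

Theorem mainTheorem1 (R : realType) :
  tiles_plane /\
  exists h : R, 0 < h /\ (entropy_seq R @ \oo --> h).
Proof.
split; first exact: KC_tiles_plane.
have C1 n : 1 <= (C_T n)%:R :> R by rewrite ler1n C_T_gt0.
have C0 n : 0 < (C_T n)%:R :> R by rewrite ltr0n C_T_gt0.
have a0 n : 0 <= ln (C_T n)%:R :> R by exact: ln_ge0 (C1 n).
have sub m n q : (0 < m)%N -> (n <= q * m)%N ->
    ln (C_T n)%:R <= q%:R ^+ 2 * ln (C_T m)%:R :> R.
  move=> m0 nqm.
  rewrite -natrX mulr_natl -lnXn// ler_ln ?posrE ?exprn_gt0//.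
  by rewrite -natrX ler_nat -mulnn C_T_cover.
have lim := square_subadditive_cvg R (fun n => ln (C_T n)%:R) a0 sub.
eexists; split; last exact: lim.
(* For every n > 0, n^2 ln 2 <= ln C_T(615 n) <= 615^2 ln C_T(n), which bounds the infimum from
   below. *)
apply: (@lt_le_trans _ _ (ln 2 / 615%:R ^+ 2)).
  by rewrite divr_gt0 ?exprn_gt0 ?ltr0n// ln_gt0// ltr1n.
apply: lb_le_inf; first by eexists; exists 1%N.
move=> _ [n /= n0 <-].
rewrite ler_pdivlMr ?exprn_gt0 ?ltr0n// mulrAC ler_pdivrMr ?exprn_gt0 ?ltr0n//.
rewrite [leRHS]mulrC; apply: le_trans (sub n (615 * n)%N 615%N n0 (leqnn _)).
rewrite -natrX mulr_natr -lnXn// ler_ln ?posrE ?exprn_gt0//.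
by rewrite -natrX ler_nat -mulnn swappable_lower_bound.
Qed.
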